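(* There exists a randomized algorithm that, given query access to a function $f\colon\{-1,1\}^n\to\{-1,1\}$ and parameters $k\ge 1$ (an integer) and $\epsilon\in(0,1)$, satisfies the following. (1) If $f$ is $\epsilon/16$-close to some $k$-junta, then the algorithm accepts with high constant probability (at least $2/3$). (2) If $f$ is $\epsilon$-far from every $4k$-junta, then the algorithm rejects with high constant probability (at least $2/3$). The query complexity of the algorithm is $\mathrm{poly}(k,1/\epsilon)$; that is, there is a fixed polynomial $p$, independent of $n$ and $f$, such that the algorithm makes at most $p(k,1/\epsilon)$ queries to $f$.
   Context: For $f,g\colon\{-1,1\}^n\to\{-1,1\}$, $\mathrm{dist}(f,g)=\Pr_x[f(x)\ne g(x)]$ with $x$ uniform in $\{-1,1\}^n$. A function is a $k$-junta if it depends on at most $k$ of its variables: there is $T\subseteq[n]$, $|T|\le k$, such that $f(x)=f(y)$ whenever $x_i=y_i$ for all $i\in T$. $f$ is $\epsilon$-close to $g$ if $\mathrm{dist}(f,g)\le\epsilon$, and $\epsilon$-far from $g$ if $\mathrm{dist}(f,g)>\epsilon$. Query access means that the algorithm may adaptively request $f(x)$ for points $x\in\{-1,1\}^n$ of its choice; query complexity is the maximum number of such requests. *)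

(* Defs.v *)
From HB Require Import structures.
From mathcomp Require Import all_boot all_order all_algebra.
From mathcomp Require Import reals.

Set Implicit Arguments.
Unset Strict Implicit.
Unset Printing Implicit Defensive.

Import Order.TTheory GRing.Theory Num.Theory.
Local Open Scope ring_scope.

(* The two-element set {-1, 1} is encoded by bool, via b |-> (-1) ^+ b: only
   equality of signs is ever used, never their arithmetic. *)
Definition cube (n : nat) := {ffun 'I_n -> bool}.

Definition boolfun (n : nat) := cube n -> bool.

Definition dist (R : realType) n (f g : boolfun n) : R :=
  #|[set x | f x != g x]|%:R / #|{: cube n}|%:R.

Definition close (R : realType) n (eps : R) (f g : boolfun n) : Prop :=
  dist R f g <= eps.

Definition far (R : realType) n (eps : R) (f g : boolfun n) : Prop :=
  dist R f g > eps.

Definition junta n (k : nat) (f : boolfun n) : Prop :=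
  exists T : {set 'I_n}, (#|T| <= k)%N /\
    forall x y : cube n, (forall i, i \in T -> x i = y i) -> f x = f y.

(* Randomized adaptive algorithms with query access to a function on the
   n-cube, as randomized decision trees. [Output true] accepts and
   [Output false] rejects; [Draw m c] draws i uniformly from {0, ..., m},
   independently of all earlier draws, and goes on as [c i]. A tree learns about
   the input function only through the answers passed to its [Query] nodes. *)
Inductive algorithm (n : nat) : Type :=
| Output (b : bool)
| Query (x : cube n) (c : bool -> algorithm n)
| Draw (m : nat) (c : 'I_m.+1 -> algorithm n).

(* The probability, over the draws of A, that A outputs b on input f. *)
Fixpoint output_prob (R : realType) n (f : boolfun n) (b : bool)
    (A : algorithm n) : R :=
  match A with
  | Output b' => (b' == b)%:R
  | Query x c => output_prob R f b (c (f x))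
  | Draw m c => (\sum_(i < m.+1) output_prob R f b (c i)) / m.+1%:R
  end.

Definition accept_prob (R : realType) n (f : boolfun n) (A : algorithm n) : R :=
  output_prob R f true A.

Definition reject_prob (R : realType) n (f : boolfun n) (A : algorithm n) : R :=
  output_prob R f false A.

(* Maximum, over all outcomes of the draws, of the number of queries to f. *)
Fixpoint query_count n (f : boolfun n) (A : algorithm n) : nat :=
  match A with
  | Output _ => 0
  | Query x c => (query_count f (c (f x))).+1
  | Draw m c => \max_(i < m.+1) query_count f (c i)
  end.

(* Main.v *)
(* For a set S of coordinates let h S be the probability that f changes its
   value when the coordinates in S are rerandomized. By Fourier analysis h is a
   nonnegative combination of the functions S |-> [A meets S], hence monotone and
   submodular; f is eps-far from m-juntas only if h (~: T) >= eps for all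
   #|T| <= m, and eps/16-close to a k-junta only if h (~: T) <= eps / 8 for some
   #|T| <= k. The coordinates are first put at random into poly(k, 1/eps) parts,
   which costs only a constant factor in the first property. It then suffices to
   decide whether the minimum over the sets S of parts of h S + lam * #|~: S|,
   with lam = eps / (16 k), is at most 3 eps / 16 or at least eps / 4: if
   #|~: S| > 4 k then the penalty alone is at least eps / 4. This minimum is
   estimated by projected stochastic subgradient descent on the Lovász extension,
   each subgradient estimate costing two queries per part. The average of the
   values <gradient, point> met on the way is at least the minimum up to
   fluctuations, and at most the value of any fixed S up to the regret. *)

Require Import Defs.
From HB Require Import structures.
From mathcomp Require Import all_boot all_order all_algebra.
From mathcomp Require Import reals.
From mathcomp Require Import ring lra.

Set Implicit Arguments.
Unset Strict Implicit.
Unset Printing Implicit Defensive.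

Import Order.TTheory GRing.Theory Num.Theory.
Local Open Scope ring_scope.

(** * Averages, sampling and concentration *)

Section Average.
Variable R : realType.

Definition avg (U : finType) (F : U -> R) : R := (\sum_u F u) / #|U|%:R.

Lemma eq_avg (U : finType) (F G : U -> R) : F =1 G -> avg F = avg G.
Proof. by move=> e; rewrite /avg (eq_bigr G). Qed.

Lemma ler_avg (U : finType) (F G : U -> R) :
  (forall u, F u <= G u) -> avg F <= avg G.
Proof. by move=> le; rewrite ler_wpM2r ?invr_ge0 ?ler0n ?ler_sum. Qed.

Lemma avg_cst (U : finType) (u0 : U) (a : R) : avg (fun _ : U => a) = a.
Proof.
rewrite /avg sumr_const -[a *+ _]mulr_natr mulfK // pnatr_eq0 -lt0n.
by apply/card_gt0P; exists u0.
Qed.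

Lemma avgD (U : finType) (F G : U -> R) :
  avg (fun u => F u + G u) = avg F + avg G.
Proof. by rewrite /avg big_split mulrDl. Qed.

Lemma avgZ (U : finType) (a : R) (F : U -> R) :
  avg (fun u => a * F u) = a * avg F.
Proof. by rewrite /avg -mulr_sumr mulrA. Qed.

Lemma avgN (U : finType) (F : U -> R) : avg (fun u => - F u) = - avg F.
Proof. by rewrite /avg sumrN mulNr. Qed.

Lemma avg_sum (U I : finType) (P : pred I) (F : I -> U -> R) :
  avg (fun u => \sum_(i | P i) F i u) = \sum_(i | P i) avg (F i).
Proof. by rewrite /avg exchange_big mulr_suml. Qed.

Lemma avg_ge_min (U : finType) (u0 : U) (F : U -> R) :
  exists u, F u <= avg F.
Proof.
apply/existsP; apply: contraT; rewrite negb_exists => /forallP lt.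
have cU : (0 : R) < #|U|%:R by rewrite ltr0n; apply/card_gt0P; exists u0.
have: avg (fun _ : U => avg F) < avg F.
  rewrite !/avg ltr_pM2r ?invr_gt0 // ltr_sum //.
    by apply/hasP; exists u0; rewrite ?mem_index_enum.
  by move=> u _; rewrite ltNge lt.
by rewrite (avg_cst u0) ltxx.
Qed.

End Average.

(** * Uniform draws from finite types and batches of queries, as decision trees *)

Section Sampling.
Variables (R : realType) (n : nat) (f : boolfun n).

(** [Draw m] ranges over [m.+1] values, hence the predecessor; [u0] witnesses that [U] is nonempty
    and serves as the default of [nth]. *)
Definition sample (U : finType) (u0 : U) (c : U -> algorithm n) : algorithm n :=
  Draw (fun i : 'I_(#|U|.-1.+1) => c (nth u0 (enum U) i)).

Lemma output_prob_sample (U : finType) (u0 : U) c b :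
  output_prob R f b (sample u0 c) = avg (fun u => output_prob R f b (c u)).
Proof.
have cU : #|U|.-1.+1 = #|U| by rewrite prednK //; apply/card_gt0P; exists u0.
rewrite /= /avg cU; congr (_ / _).
transitivity (\sum_(u <- enum U) output_prob R f b (c u)); last by rewrite big_enum.
by rewrite (big_nth u0) -cardE -cU big_mkord.
Qed.

Lemma query_count_sample (U : finType) (u0 : U) c q :
  (forall u, query_count f (c u) <= q)%N -> (query_count f (sample u0 c) <= q)%N.
Proof. by move=> le /=; apply/bigmax_leqP. Qed.

Fixpoint ask (qs : seq (cube n)) (c : seq bool -> algorithm n) : algorithm n :=
  if qs is q :: qs' then Query q (fun b => ask qs' (fun bs => c (b :: bs)))
  else c [::].

Lemma output_prob_ask qs c b :
  output_prob R f b (ask qs c) = output_prob R f b (c (map f qs)).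
Proof. by elim: qs c => //= q qs IH c; rewrite IH. Qed.

Lemma query_count_ask qs c :
  query_count f (ask qs c) = (size qs + query_count f (c (map f qs)))%N.
Proof. by elim: qs c => //= q qs IH c; rewrite IH. Qed.

Lemma output_probC b A :
  output_prob R f b A + output_prob R f (~~ b) A = 1.
Proof.
elim: A => [b'|x c IH|m c IH] /=; first by case: b; case: b'; rewrite ?addr0 ?add0r.
  exact: IH.
rewrite -mulrDl -big_split /= (eq_bigr (fun=> 1)) => [|i _]; last exact: IH.
by rewrite sumr_const card_ord divff // pnatr_eq0.
Qed.

Lemma output_prob_le1 b A : output_prob R f b A <= 1.
Proof.
elim: A => [b'|x c IH|m c IH] /=; [by case: (_ == _)|exact: IH|].
rewrite ler_pdivrMr ?ltr0n // mul1r -[X in _ <= X%:R]card_ord -sum1_card natr_sum.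
by rewrite ler_sum.
Qed.

Lemma output_prob_ge0 b A : 0 <= output_prob R f b A.
Proof. by have := output_probC b A; have := output_prob_le1 (~~ b) A; lra. Qed.

End Sampling.

(** * Concentration for supermartingales *)

Section Drift.
Variable R : realType.

(* Chebyshev's inequality for supermartingales: the squared positive part grows
   by at most B per round in expectation, because
   max(0, a + x)^2 <= max(0, a)^2 + 2 max(0, a) x + x^2. *)
Lemma drift_bound (St : Type) (U : finType) (u0 : U) (P : nat -> St -> R)
    (next : St -> U -> St) (inv : St -> Prop) (W : St -> R) (g B D : R) :
  0 < D -> (forall st, P 0 st <= 1) ->
  (forall st, inv st -> 0 < P 0 st -> 0 <= W st) ->
  (forall t st, P t.+1 st = avg (fun u => P t (next st u))) ->
  (forall st u, inv st -> inv (next st u)) ->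
  (forall st, inv st -> exists xi : U -> R,
     [/\ forall u, W (next st u) <= W st + xi u - g, avg xi <= 0
       & forall u, xi u ^+ 2 <= B]) ->
  forall t st, inv st ->
  P t st * D ^+ 2 <= Num.max 0 (W st - t%:R * g + D) ^+ 2 + t%:R * B.
Proof.
move=> D0 P1 bad PS inext hxi; elim=> [|t IH] st ist.
  rewrite !mul0r subr0 addr0.
  have [P0|P0] := ltP 0 (P 0 st); last first.
    by apply: (le_trans (y := 0)); rewrite ?sqr_ge0 // mulr_le0_ge0 ?sqr_ge0.
  have := bad _ ist P0 => W0.
  apply: (le_trans (y := D ^+ 2)).
    by rewrite ler_piMl ?sqr_ge0.
  by rewrite ler_sqr ?nnegrE ?le_max ?lexx ?(ltW D0) // lerDr W0 orbT.
have [xi [Wxi axi xiB]] := hxi _ ist.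
pose a := W st - t.+1%:R * g + D; pose p : R := Num.max 0 a.
have p0 : 0 <= p by rewrite le_max lexx.
rewrite PS mulrC -avgZ.
apply: (le_trans (y := avg (fun u => (p ^+ 2 + B + t%:R * B) + 2 * p * xi u))).
  apply: ler_avg => u; rewrite mulrC; apply: le_trans (IH _ (inext _ u ist)) _.
  have -> : p ^+ 2 + B + t%:R * B + 2 * p * xi u =
            (p ^+ 2 + 2 * p * xi u + B) + t%:R * B by ring.
  rewrite lerD2r.
  set q : R := Num.max 0 _.
  have q0 : 0 <= q by rewrite le_max lexx.
  have qle : q = 0 \/ q <= p + xi u.
    rewrite /q; case: (ltP 0 (_ + D)) => _; [right|by left].
    have : a <= p by rewrite le_max lexx orbT.
    have := Wxi u; rewrite /a -natr1; lra.
  have qq : q ^+ 2 <= (p + xi u) ^+ 2.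
    case: qle => [->|le]; first by rewrite expr0n sqr_ge0.
    by rewrite ler_sqr ?nnegrE // (le_trans q0).
  by have := xiB u; lra.
rewrite avgD (avg_cst u0) avgZ -natr1 -/a -/p.
have : p * avg xi <= 0 by rewrite mulr_ge0_le0.
lra.
Qed.

End Drift.

(** * Coverage functions and their Lovász extension *)

Definition hits (I : finType) (A S : {set I}) : bool :=
  [exists i in A, i \in S].

Section Hits.
Variable I : finType.
Implicit Types A B S : {set I}.

Lemma hitsP A S : reflect (exists2 i, i \in A & i \in S) (hits A S).
Proof. exact: exists_inP. Qed.

Lemma hitsS A S S' : S \subset S' -> hits A S -> hits A S'.
Proof.
by move=> /subsetP sub /hitsP[i iA iS]; apply/hitsP; exists i; last exact: sub.
Qed.

Lemma hitsU A S S' : hits A (S :|: S') = hits A S || hits A S'.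
Proof.
apply/idP/orP => [/hitsP[i iA]|[]]; last 2 first.
- by apply: hitsS; apply: subsetUl.
- by apply: hitsS; apply: subsetUr.
by rewrite inE => /orP[] iS; [left|right]; apply/hitsP; exists i.
Qed.

Lemma hits0 A : hits A set0 = false.
Proof. by apply/hitsP => -[i _]; rewrite inE. Qed.

Lemma hits0l S : hits set0 S = false.
Proof. by apply/hitsP => -[i]; rewrite inE. Qed.

Lemma hits1 A i : hits A [set i] = (i \in A).
Proof.
by apply/hitsP/idP => [[j jA]|iA]; [rewrite inE => /eqP <-|exists i; rewrite ?set11].
Qed.

End Hits.

Section Coverage.
Variables (R : realType) (J I : finType).

Definition coverage (c : J -> R) (A : J -> {set I}) (S : {set I}) : R :=
  \sum_j c j * (hits (A j) S)%:R.

Variables (c : J -> R) (A : J -> {set I}).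
Hypothesis c0 : forall j, 0 <= c j.

Lemma coverageS (S S' : {set I}) :
  S \subset S' -> coverage c A S <= coverage c A S'.
Proof.
move=> sub; apply: ler_sum => j _; rewrite ler_wpM2l // ler_nat.
by have := @hitsS _ (A j) _ _ sub; case: hits => // ->.
Qed.

Lemma coverageU (S S' : {set I}) :
  coverage c A (S :|: S') <= coverage c A S + coverage c A S'.
Proof.
rewrite -big_split /=; apply: ler_sum => j _; rewrite -mulrDr ler_wpM2l // -natrD ler_nat.
by rewrite hitsU; do 2!case: hits.
Qed.

Lemma coverage0 : coverage c A set0 = 0.
Proof. by rewrite /coverage big1 // => j _; rewrite hits0 mulr0. Qed.

Lemma coverage_ge0 (S : {set I}) : 0 <= coverage c A S.
Proof. by apply: sumr_ge0 => j _; rewrite mulr_ge0. Qed.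

Section Chain.
Variable rank : I -> nat.
Hypothesis rank_inj : injective rank.

Definition upto i := [set j | (rank j <= rank i)%N].
Definition before i := [set j | (rank j < rank i)%N].

(** Along the chain of initial segments for [rank], a nonempty set is first met at its element of
    least rank, so its indicator jumps there and nowhere else. *)
Lemma hits_chain (B : {set I}) : B != set0 ->
  exists2 i0, i0 \in B & (forall j, j \in B -> (rank i0 <= rank j)%N) /\
    forall x : I -> R, \sum_i ((hits B (upto i))%:R - (hits B (before i))%:R) * x i = x i0.
Proof.
case/set0Pn=> k kB; case: (arg_minnP rank kB) => i0 i0B mn; exists i0 => //.
split=> // x; rewrite (bigD1 i0) //= big1 ?addr0 => [|i ni0].
  have -> : hits B (upto i0) by apply/hitsP; exists i0; rewrite ?inE.
  have -> : hits B (before i0) = false.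
    by apply/hitsP => -[j jB]; rewrite inE ltnNge mn.
  by rewrite subr0 mul1r.
have [lt|gt|/rank_inj e] := ltngtP (rank i) (rank i0); last by rewrite e eqxx in ni0.
  have -> : hits B (upto i) = false.
    by apply/hitsP => -[j jB]; rewrite inE => /leq_ltn_trans /(_ lt); rewrite ltnNge mn.
  have -> : hits B (before i) = false.
    by apply/hitsP => -[j jB]; rewrite inE => /ltn_trans /(_ lt); rewrite ltnNge mn.
  by rewrite subr0 mul0r.
have -> : hits B (upto i) by apply/hitsP; exists i0; rewrite ?inE // ltnW.
have -> : hits B (before i) by apply/hitsP; exists i0; rewrite ?inE.
by rewrite subrr mul0r.
Qed.

(** Edmonds' greedy vector for the order [rank]: a vertex of the base polytope of the coverage
    function. *)
Definition marginal i := coverage c A (upto i) - coverage c A (before i).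

Lemma sum_marginalE (x : I -> R) :
  \sum_i marginal i * x i =
  \sum_j c j * \sum_i ((hits (A j) (upto i))%:R - (hits (A j) (before i))%:R) * x i.
Proof.
under [RHS]eq_bigr do rewrite mulr_sumr.
rewrite exchange_big; apply: eq_bigr => i _ /=.
rewrite /marginal -sumrB mulr_suml; apply: eq_bigr => j _.
by rewrite mulrA mulrBr.
Qed.

Lemma marginal_ge0 i : 0 <= marginal i.
Proof.
by rewrite subr_ge0 coverageS //; apply/subsetP => j; rewrite !inE; apply: ltnW.
Qed.

(** Each nonempty [A j] gives its whole weight to its element of least rank; if that element lies in
    [S], then [A j] meets [S]. *)
Lemma sum_marginal_le (S : {set I}) : \sum_(i in S) marginal i <= coverage c A S.
Proof.
rewrite big_mkcond /= (eq_bigr (fun i => marginal i * (i \in S)%:R)); last first.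
  by move=> i _; case: (i \in S); rewrite ?mulr1 ?mulr0.
rewrite sum_marginalE; apply: ler_sum => j _; rewrite ler_wpM2l //.
have [->|/hits_chain[i iA [_ ->]]] := eqVneq (A j) set0.
  by rewrite big1 // => i _; rewrite !hits0l subrr mul0r.
rewrite ler_nat; case: (boolP (i \in S)) => // iS.
by have -> : hits (A j) S by apply/hitsP; exists i.
Qed.

Lemma sum_marginalT : \sum_i marginal i = coverage c A setT.
Proof.
under eq_bigr => i _ do rewrite -[marginal i]mulr1.
rewrite (sum_marginalE (fun=> 1)); apply: eq_bigr => j _; congr (_ * _).
have [->|/hits_chain[i iA [_ /(_ (fun=> 1)) ->]]] := eqVneq (A j) set0.
  by rewrite !hits0l big1 // => i _; rewrite !hits0l subrr mul0r.
by have -> : hits (A j) setT by apply/hitsP; exists i.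
Qed.

(** When [rank] lists [z] in decreasing order, the first element of [A j] on the chain maximizes [z]
    over [A j]. The right-hand side is the Lovász extension at [z], with the greedy vector as a
    subgradient. *)
Lemma sum_marginal_max (z : I -> R) :
  (forall i, 0 <= z i) -> (forall i j, (rank i <= rank j)%N -> z j <= z i) ->
  \sum_i marginal i * z i = \sum_j c j * \big[Num.max/0]_(i in A j) z i.
Proof.
move=> z0 zrank; rewrite sum_marginalE; apply: eq_bigr => j _; congr (_ * _).
have [->|/hits_chain[i iA [mn ->]]] := eqVneq (A j) set0.
  by rewrite big_set0 big1 // => i _; rewrite !hits0l subrr mul0r.
apply/le_anti/andP; split; first exact: le_bigmax_cond.
by apply/bigmax_leP; split=> // k kA; apply/zrank/mn.
Qed.

End Chain.

(* Peeling off the level set of the least nonzero value of z, by induction on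
   the size of the support. *)
Lemma lovasz_ge (lam nu M : R) (z : I -> R) :
  (forall S, nu <= coverage c A S - lam * #|S|%:R) ->
  (forall i, 0 <= z i <= M) -> 0 <= M ->
  nu * M <= \sum_j c j * \big[Num.max/0]_(i in A j) z i - lam * \sum_i z i.
Proof.
move=> hS; have nu0 : nu <= 0 by have := hS set0; rewrite coverage0 cards0; lra.
have [m] := ubnP #|[set i | z i != 0]|; elim: m z M => // m IH z M.
rewrite ltnS => cm zM M0.
have [e|[i0]] := set_0Vmem [set i | z i != 0].
  have ez i : z i = 0.
    by apply/eqP; have := in_set0 i; rewrite -e inE => /negbFE.
  rewrite [\sum_i z i]big1 // mulr0 subr0.
  apply: (le_trans (y := 0)); first by rewrite mulr_le0_ge0.
  apply: sumr_ge0 => j _; rewrite mulr_ge0 //.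
  by elim/big_ind: _ => // [x y x0 y0|i _]; rewrite ?ez // le_max x0.
rewrite inE => zi0.
set S := [set i | z i != 0] in cm.
have i0S : i0 \in S by rewrite inE.
have [i1] : exists2 i1, i1 \in S & forall j, j \in S -> z i1 <= z j.
  by case: (Order.TotalTheory.arg_minP z i0S) => i1 iS mn; exists i1.
set v := z i1; rewrite inE => v0 vmin.
have vpos : 0 < v by rewrite lt_def v0; case/andP: (zM i1).
pose z' i := z i - v * (i \in S)%:R.
have z'0 i : 0 <= z' i.
  rewrite /z'; case: (boolP (i \in S)) => iS; first by rewrite mulr1 subr_ge0 vmin.
  by rewrite mulr0 subr0; case/andP: (zM i).
have z'out i : i \notin S -> z i = 0 by rewrite inE negbK => /eqP.
have vM : v <= M by case/andP: (zM i1).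
(* Subtracting [v] on the support lowers the upper bound to [M - v]: the induction supplies
   [nu * (M - v)], and the level set [S] the remaining [nu * v]. *)
have z'M i : 0 <= z' i <= M - v.
  rewrite z'0 /z'; case: (boolP (i \in S)) => [iS|/z'out ->].
    by rewrite mulr1 lerD2r; case/andP: (zM i).
  by rewrite mulr0 subrr subr_ge0.
have cm' : (#|[set i | z' i != 0%R]| < m)%N.
  apply: leq_trans cm; apply: proper_card; apply/properP; split.
    apply/subsetP => i; rewrite !inE; apply: contra => /eqP z0.
    by rewrite /z' inE z0 eqxx mulr0 subrr.
  exists i1; first by rewrite inE.
  by rewrite inE negbK /z' inE v0 mulr1 subrr.
have Mv : 0 <= M - v by rewrite subr_ge0.
have := IH _ _ cm' z'M Mv.
have sumz : \sum_i z i = v * #|S|%:R + \sum_i z' i.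
  rewrite -sum1_card natr_sum mulr_sumr [\sum_(i in S) _]big_mkcond -big_split /=.
  apply: eq_bigr => i _; rewrite /z'; case: (i \in S); rewrite ?mulr1 ?mulr0; ring.
have maxz j : v * (hits (A j) S)%:R + \big[Num.max/0]_(i in A j) z' i
              <= \big[Num.max/0]_(i in A j) z i.
  case: (boolP (hits (A j) S)) => [/hitsP[k kA kS]|nm].
    rewrite mulr1 -lerBrDl; apply/bigmax_leP; split.
      by rewrite subr_ge0; apply: le_trans (vmin _ kS) _; apply: le_bigmax_cond.
    move=> i iA; rewrite lerBrDl; case: (boolP (i \in S)) => iS.
      by rewrite /z' iS mulr1 addrC subrK; apply: le_bigmax_cond.
    rewrite /z' (negbTE iS) mulr0 subr0 z'out // addr0.
    by apply: le_trans (vmin _ kS) _; apply: le_bigmax_cond.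
  rewrite mulr0 add0r; apply/bigmax_leP; split.
    exact: bigmax_ge_id.
  move=> i iA; apply: le_trans (le_bigmax_cond _ _ iA).
  by rewrite /z' lerBlDr lerDl mulr_ge0 // ltW.
have sumc : v * coverage c A S + \sum_j c j * \big[Num.max/0]_(i in A j) z' i
            <= \sum_j c j * \big[Num.max/0]_(i in A j) z i.
  rewrite /coverage mulr_sumr -big_split; apply: ler_sum => j _ /=.
  by rewrite mulrCA -mulrDr ler_wpM2l.
have := hS S; rewrite -(ler_pM2l vpos) sumz; nra.
Qed.

End Coverage.

(** * Influence *)

Section Influence.
Variables (R : realType) (n : nat).
Implicit Types (f g : boolfun n) (S T : {set 'I_n}) (x y : cube n).

Definition hybrid S x y : cube n := [ffun i => if i \in S then y i else x i].

Definition influence f S : R :=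
  avg (fun xy : cube n * cube n => (f xy.1 != f (hybrid S xy.1 xy.2))%:R).

Definition cube0 : cube n := [ffun=> false].

Lemma avg_pair (U V : finType) (F : U -> V -> R) :
  avg (fun uv : U * V => F uv.1 uv.2) = avg (fun u => avg (F u)).
Proof.
rewrite /avg card_prod natrM invfM -(pair_bigA _ F) /= -mulr_suml -mulrA.
by rewrite [_^-1 * _]mulrC.
Qed.

Let sgn (b : bool) : R := (-1) ^+ b.

Definition character (A : {set 'I_n}) x : R := \prod_(i in A) sgn (x i).

Lemma prod_natr_bool (I : finType) (b : pred I) :
  \prod_i (b i)%:R = [forall i, b i]%:R :> R.
Proof.
case: (boolP [forall i, b i]) => [/forallP bT|].
  by rewrite big1 // => i _; rewrite bT.
rewrite negb_forall => /existsP[i /negbTE bi].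
by rewrite (bigD1 i) //= bi mul0r.
Qed.

(* Both sides equal the product over the coordinates i outside S of
   2 * (x i == x' i). *)
Lemma character_kernel S x x' :
  \sum_y (hybrid S x y == x')%:R =
  \sum_A (~~ hits A S)%:R * (character A x * character A x').
Proof.
transitivity (\prod_i \sum_b ((if i \in S then b else x i) == x' i)%:R : R).
  rewrite bigA_distr_bigA; apply: eq_bigr => y _.
  rewrite prod_natr_bool; congr (nat_of_bool _)%:R.
  apply/eqP/forallP => [<- i|e]; first by rewrite ffunE.
  by apply/ffunP => i; rewrite ffunE; apply/eqP.
transitivity (\prod_i ((i \notin S)%:R * (sgn (x i) * sgn (x' i)) + 1)).
  apply: eq_bigr => i _; rewrite big_bool /sgn.
  by case: (i \in S); case: (x i); case: (x' i) => /=; ring.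
rewrite bigA_distr; apply: eq_bigr => A _.
rewrite -big_mkcond /= big_split big_split /=; congr (_ * _).
rewrite big_mkcond /=.
rewrite (eq_bigr (fun i => ((i \in A) ==> (i \notin S))%:R)); last first.
  by move=> i _; case: (i \in A).
rewrite prod_natr_bool; congr (nat_of_bool _)%:R.
apply/forallP/idP => [h|/negP h i].
  by apply/negP => /hitsP[i iA iS]; have := h i; rewrite iA iS.
by apply/implyP => iA; apply/negP => iS; apply: h; apply/hitsP; exists i.
Qed.

Let fourier f A : R := avg (fun x => sgn (f x) * character A x).

(** Summing over the possible values x' of the hybrid point gives a quadratic form with the kernel
    of [character_kernel], in which every character contributes a square. *)
Lemma noise_fourier f S :
  avg (fun x => avg (fun y => sgn (f x) * sgn (f (hybrid S x y)))) =
  \sum_A (~~ hits A S)%:R * fourier f A ^+ 2.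
Proof.
pose N : R := #|{: cube n}|%:R.
transitivity ((\sum_x \sum_x' sgn (f x) * sgn (f x') *
                 \sum_y (hybrid S x y == x')%:R) / (N * N)).
  rewrite /avg -/N -mulr_suml invfM mulrA; congr (_ / _ / _).
  apply: eq_bigr => x _; under [RHS]eq_bigr do rewrite mulr_sumr.
  rewrite exchange_big; apply: eq_bigr => y _ /=.
  rewrite (bigD1 (hybrid S x y)) //= eqxx mulr1 big1 ?addr0 // => x'.
  by rewrite eq_sym => /negbTE ->; rewrite mulr0.
under eq_bigr => x _ do under eq_bigr => x' _ do rewrite character_kernel mulr_sumr.
under eq_bigr => x _ do rewrite exchange_big.
rewrite exchange_big mulr_suml; apply: eq_bigr => A _ /=.
rewrite /fourier /avg -/N expr2 mulrACA -invfM mulrA; congr (_ / _).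
rewrite mulr_suml mulr_sumr; apply: eq_bigr => x _.
rewrite mulr_sumr mulr_sumr; apply: eq_bigr => x' _; ring.
Qed.

Lemma hybrid0 x y : hybrid set0 x y = x.
Proof. by apply/ffunP => i; rewrite ffunE inE. Qed.

(** A change of sign is 1/2 minus half the product of the two signs. By Parseval, the case
    [S = set0] of [noise_fourier], the constant is half the sum of all squared coefficients, so that
    exactly the [A] meeting [S] remain. *)
Lemma influence_coverage f : exists2 c : {set 'I_n} -> R,
  forall A, 0 <= c A & forall S, influence f S = coverage c id S.
Proof.
exists (fun A => fourier f A ^+ 2 / 2) => [A|S].
  by rewrite divr_ge0 ?sqr_ge0 ?ler0n.
have infE : influence f S = 1 / 2 +
    (- (1 / 2)) * avg (fun x => avg (fun y => sgn (f x) * sgn (f (hybrid S x y)))).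
  rewrite /influence (avg_pair (fun x y => (f x != f (hybrid S x y))%:R)).
  rewrite -avgZ -[X in _ = X + _](avg_cst cube0) -avgD; apply: eq_avg => x.
  rewrite -avgZ -[X in _ = X + _](avg_cst cube0) -avgD; apply: eq_avg => y.
  by rewrite /sgn; case: (f x); case: (f _) => /=; field.
have parseval : \sum_A fourier f A ^+ 2 = 1.
  transitivity (\sum_A (~~ hits A set0)%:R * fourier f A ^+ 2).
    by apply: eq_bigr => A _; rewrite hits0 mul1r.
  rewrite -noise_fourier -[RHS](avg_cst cube0); apply: eq_avg => x.
  rewrite -[RHS](avg_cst cube0); apply: eq_avg => y.
  by rewrite hybrid0 -expr2 sqrr_sign.
rewrite infE noise_fourier -[X in X + _]mulr1 -[X in _ * X + _]parseval !mulr_sumr -big_split /=.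
by apply: eq_bigr => A _; case: hits => /=; ring.
Qed.

Lemma influenceS f S T : S \subset T -> influence f S <= influence f T.
Proof. by have [c c0 e] := influence_coverage f; rewrite !e; apply: coverageS. Qed.

Lemma influenceU f S T : influence f (S :|: T) <= influence f S + influence f T.
Proof. by have [c c0 e] := influence_coverage f; rewrite !e; apply: coverageU. Qed.

Lemma influence_le1 f S : influence f S <= 1.
Proof.
rewrite -[leRHS](avg_cst (cube0, cube0)); apply: ler_avg => xy.
by case: (_ != _).
Qed.

Lemma distE f g : dist R f g = avg (fun x => (f x != g x)%:R).
Proof.
rewrite /dist /avg -sum1_card natr_sum big_mkcond /=; congr (_ / _).
by apply: eq_bigr => x _; rewrite inE; case: (_ != _).
Qed.


(* The juntas obtained by freezing the coordinates outside T to those of y are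
   at average distance influence f (~: T) from f. *)
Lemma far_influence f k (eps : R) T :
  (forall g, junta k g -> far eps f g) -> (#|T| <= k)%N ->
  eps <= influence f (~: T).
Proof.
move=> hf cT.
have [y le] := avg_ge_min cube0 (fun y => dist R f (fun x => f (hybrid (~: T) x y))).
have -> : influence f (~: T) =
          avg (fun y => dist R f (fun x => f (hybrid (~: T) x y))).
  rewrite /influence (avg_pair (fun x y => (f x != f (hybrid (~: T) x y))%:R)).
  under [RHS]eq_avg do rewrite distE.
  by rewrite /avg -!mulr_suml exchange_big.
apply: le_trans le; apply/ltW/hf; exists T; split=> // u v uv; congr f.
by apply/ffunP => i; rewrite !ffunE inE; case: (boolP (i \in T)) => //= /uv.
Qed.

(** Exchanging x and y on the coordinates in [S] is an involution of pairs, so the hybrid point is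
    uniform. *)
Lemma avg_hybrid S (F : cube n -> R) :
  avg (fun xy : cube n * cube n => F (hybrid S xy.1 xy.2)) = avg F.
Proof.
pose swap (xy : cube n * cube n) := (hybrid S xy.1 xy.2, hybrid S xy.2 xy.1).
have swapK : involutive swap.
  by case=> x y; congr pair; apply/ffunP => i; rewrite !ffunE; case: (i \in S).
have bij : {on predT, bijective swap} by apply: onW_bij; apply: inv_bij.
transitivity (avg (fun xy : cube n * cube n => F xy.1)).
  by rewrite /avg [in RHS](reindex swap).
by rewrite (avg_pair (fun x _ => F x)); apply: eq_avg => x; rewrite (avg_cst cube0).
Qed.

(** Since [g] agrees at x and at the hybrid point, a change of [f] forces [f] and [g] to differ at
    one of the two, and both are uniform. *)
Lemma close_influence f g T :
  (forall x y, (forall i, i \in T -> x i = y i) -> g x = g y) ->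
  influence f (~: T) <= 2 * dist R f g.
Proof.
move=> gT; rewrite mulr_natl mulr2n distE.
rewrite -{1}[avg _](avg_hybrid set0) -(avg_hybrid (~: T) (fun x => (f x != g x)%:R)) -avgD.
apply: ler_avg => -[x y] /=; rewrite hybrid0.
have -> : g (hybrid (~: T) x y) = g x.
  by apply: gT => i iT; rewrite ffunE inE iT.
by rewrite -natrD ler_nat; case: (f x); case: (f _); case: (g x).
Qed.

End Influence.

(** * Random partitions *)

Section Structure.
Variables (R : realType) (J I : finType) (c : J -> R) (A : J -> {set I}).
Hypothesis c0 : forall j, 0 <= c j.
Let h := coverage c A.
Variable beta : R.
Hypothesis beta0 : 0 < beta.

(** A point of the polymatroid of [h]; the cap [beta] prevents few coordinates from carrying much of
    the total. *)
Definition spread (tau : R) (w : I -> R) : Prop :=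
  [/\ forall i, 0 <= w i <= beta, tau <= \sum_i w i
    & forall S : {set I}, \sum_(i in S) w i <= h S].

(* The block B maximizes h B - beta * #|B| over the subsets of D. If h B < tau,
   every single coordinate of D adds at most beta to h B, and the weights are
   the increments of h along an enumeration of D, starting from B. *)
Lemma block_or_spread (D : {set I}) (tau : R) : h setT <= 1 -> 2 * tau <= h D ->
  (exists B : {set I}, [/\ B \subset D, #|B|%:R <= beta^-1 & tau <= h B]) \/
  (exists w, spread tau w).
Proof.
move=> h1 hD.
have [B BD Bmax] := @Order.TotalTheory.arg_maxP _ _ _ set0 (fun B => B \subset D)
  (fun B => h B - beta * #|B|%:R) (sub0set D).
have cB : #|B|%:R <= beta^-1.
  have /= := Bmax set0 (sub0set D).
  rewrite /h (coverage0 c A) cards0 mulr0 subr0 subr_ge0 => le.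
  rewrite -[leRHS]mul1r ler_pdivlMr // mulrC; apply: le_trans le _.
  by apply: le_trans h1; apply: coverageS => //; apply: subsetT.
have [le|lt] := leP tau (h B); [by left; exists B|right].
(* [coverage c' A' S] is [h (B :|: (D :&: S)) - h B], the contraction of [h] by [B] restricted to
   [D]. *)
pose c' j := c j * (~~ hits (A j) B)%:R; pose A' j := A j :&: D.
have c'0 j : 0 <= c' j by rewrite mulr_ge0.
have hitsI j S : hits (A' j) S = hits (A j) (D :&: S).
  apply/hitsP/hitsP => -[i iA iS]; exists i; move: iA iS; rewrite !inE.
  - by case/andP.
  - by case/andP=> _ ->.
  - by move=> iA /andP[-> _]; rewrite iA.
  - by move=> iA /andP[_ ->].
pose rk := fun i : I => nat_of_ord (enum_rank i).
have rk_inj : injective rk by move=> i j /val_inj /enum_rank_inj.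
exists (marginal c' A' rk); split=> [i||S].
- rewrite marginal_ge0 //= lerBlDr.
  apply: (le_trans (y := coverage c' A' ([set i] :|: before rk i))).
    apply: coverageS => //; apply/subsetP => j; rewrite !inE leq_eqVlt.
    by case/orP => [/eqP /rk_inj ->|->]; rewrite ?eqxx ?orbT.
  apply: le_trans (coverageU _ _ _ _) _ => //; rewrite lerD2r.
  have [iD|iD] := boolP (i \in D); last first.
    rewrite /coverage big1 ?ltW // => j _; rewrite hitsI.
    have -> : D :&: [set i] = set0.
      by apply/setP => k; rewrite !inE; apply/andP => -[kD /eqP ki]; rewrite -ki kD in iD.
    by rewrite hits0 mulr0.
  have : coverage c' A' [set i] <= h (i |: B) - h B.
    rewrite /h /coverage -sumrB; apply: ler_sum => j _.
    rewrite hitsI (setIidPr _) ?sub1set // hitsU hits1 /c' -mulrBr -mulrA.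
    rewrite ler_wpM2l //.
    by case: (hits _ B); case: (i \in A j); rewrite /= ?subrr ?mul0r ?mul1r ?subr0.
  have iBD : i |: B \subset D by rewrite subUset sub1set iD.
  have /= := Bmax _ iBD.
  have : beta * #|i |: B|%:R <= beta * #|B|%:R + beta.
    rewrite -[X in _ + X]mulr1 -mulrDr (ler_wpM2l (ltW beta0)) // natr1 ler_nat cardsU1.
    by case: (i \in B) => /=; rewrite ?add0n ?add1n.
  lra.
- rewrite sum_marginalT //.
  have : h D - h B <= coverage c' A' setT.
    rewrite /h /coverage -sumrB; apply: ler_sum => j _.
    rewrite hitsI setIT /c' -mulrBr -mulrA ler_wpM2l //.
    by case: (hits _ B); case: (hits _ D); rewrite /= ?subrr ?mul0r ?mul1r ?subr0 ?sub0r ?lerN10.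
  by lra.
- apply: le_trans (sum_marginal_le A' c'0 rk_inj S) _; apply: ler_sum => j _.
  rewrite hitsI /c' -mulrA ler_wpM2l // -natrM ler_nat.
  have [hi|] := boolP (hits _ (D :&: S)); last by rewrite muln0.
  have -> : hits (A j) S by apply: hitsS hi; apply: subsetIr.
  by case: (~~ _).
Qed.

(** Disjoint blocks of value at least [tau] are extracted one by one into [Q], up to [r] of them;
    deleting fewer than [r] coordinates then leaves some block intact. The extraction stops early
    only if [h] is small outside [Q] or the weight is spread. *)
Lemma core_or_spread (tau : R) (r : nat) : h setT <= 1 ->
  exists Q : {set I}, #|Q|%:R <= r%:R * beta^-1 /\
    [\/ forall V : {set I}, (#|V| < r)%N -> tau <= h (Q :\: V),
        h (~: Q) <= 2 * tau
      | exists w, spread tau w].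
Proof.
move=> h1; elim: r => [|r [Q [cQ hQ]]].
  by exists set0; rewrite cards0 mul0r; split=> //; constructor 1.
have step : r%:R * beta^-1 <= r.+1%:R * beta^-1.
  by rewrite ler_wpM2r ?invr_ge0 ?(ltW beta0) // ler_nat.
case: hQ => [hQ|hQ|hQ]; [|exists Q; split; [exact: le_trans cQ step|by constructor 2]
  |exists Q; split; [exact: le_trans cQ step|by constructor 3]].
have [le|lt] := leP (h (~: Q)) (2 * tau).
  by exists Q; split; [exact: le_trans cQ step|constructor 2].
case: (block_or_spread h1 (ltW lt)) => [[B [BQ cB hB]]|hw]; last first.
  by exists Q; split; [exact: le_trans cQ step|constructor 3].
exists (Q :|: B); split.
  rewrite -natr1 mulrDl mul1r; apply: le_trans (lerD cQ cB).
  by rewrite -natrD ler_nat cardsU leq_subr.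
(* If [V] misses the new block, that block survives. Otherwise [V :\: B] is smaller than [V], and
   the induction hypothesis applies to it in the old [Q]. *)
constructor 1 => V cV.
have [VB|/set0Pn[i]] := eqVneq (V :&: B) set0.
  apply: le_trans hB _; apply: coverageS => //; apply/subsetP => i iB.
  rewrite !inE iB orbT andbT; apply/negP => iV.
  by have := in_set0 i; rewrite -VB inE iV iB.
rewrite inE => /andP[iV iB].
have cVB : (#|V :\: B| < r)%N.
  rewrite -ltnS; apply: leq_trans cV; rewrite ltnS; apply: proper_card.
  by apply/properP; split; [exact: subsetDl|exists i; rewrite // inE iB].
apply: le_trans (hQ _ cVB) _; apply: coverageS => //; apply/subsetP => j.
rewrite !inE negb_and negbK => /andP[/orP[jB|jV] jQ]; last by rewrite jV jQ.
by have := subsetP BQ _ jB; rewrite inE jQ.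
Qed.

End Structure.

(** * Merging coordinates into uniformly random parts *)

Section Partition.
Variables (R : realType) (n l : nat).
Notation partition := {ffun 'I_n -> 'I_l.+1}.
Let L : R := l.+1%:R.

Definition part0 : partition := [ffun=> ord0].

(** Adding a to the part of i permutes the partitions, so the [l.+1] events [phi i + a = phi j] are
    equally likely, and exactly one of them occurs. *)
Lemma avg_collision i j : i != j ->
  avg (fun phi : partition => (phi i == phi j)%:R : R) = L^-1.
Proof.
move=> ij.
pose shift (a : 'I_l.+1) (phi : partition) : partition :=
  [ffun k => if k == i then phi k + a else phi k].
have shiftK a : cancel (shift a) (shift (- a)).
  by move=> phi; apply/ffunP => k; rewrite !ffunE; case: eqP => // _; rewrite addrK.
have shiftNK a : cancel (shift (- a)) (shift a).
  by move=> phi; apply/ffunP => k; rewrite !ffunE; case: eqP => // _; rewrite subrK.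
pose p := avg (fun phi : partition => (phi i == phi j)%:R : R).
have pE a : avg (fun phi : partition => (phi i + a == phi j)%:R) = p.
  rewrite /p /avg [in RHS](reindex (shift a)) /=.
    by congr (_ / _); apply: eq_bigr => phi _; rewrite !ffunE eqxx (eq_sym j) (negbTE ij).
  by apply: onW_bij; exists (shift (- a)).
have : L * p = 1.
  rewrite /L -[X in X%:R]card_ord mulr_natl -sumr_const.
  rewrite (eq_bigr (fun a => avg (fun phi : partition => (phi i + a == phi j)%:R))); last first.
    by move=> a _; rewrite pE.
  rewrite -avg_sum -[RHS](avg_cst part0); apply: eq_avg => phi.
  rewrite (bigD1 (phi j - phi i)) //= [phi i + _]addrC subrK eqxx big1 ?addr0 // => a.
  by rewrite eq_sym subr_eq eq_sym addrC => /negbTE ->.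
move=> e; apply: (mulfI (_ : L != 0)); first by rewrite pnatr_eq0.
by rewrite e mulfV // pnatr_eq0.
Qed.

(** Markov's inequality for the number of ordered colliding pairs in [Q]. *)
Lemma avg_not_injective (Q : {set 'I_n}) (bad : pred partition) :
  (forall phi : partition, {in Q &, injective phi} -> ~~ bad phi) ->
  avg (fun phi => (bad phi)%:R) <= #|Q|%:R ^+ 2 / L.
Proof.
move=> hbad.
apply: (le_trans (y := avg (fun phi : partition =>
    \sum_(i in Q) \sum_(j in Q :\ i) (phi i == phi j)%:R))).
  apply: ler_avg => phi.
  have s0 i : 0 <= \sum_(j in Q :\ i) (phi i == phi j)%:R :> R.
    by apply: sumr_ge0.
  have [|bphi] := boolP (bad phi); last by apply: sumr_ge0.
  apply: contraTT; rewrite -ltNge => lt1; apply: hbad => i j iQ jQ e.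
  apply/eqP; apply: contraTT lt1 => ij; rewrite -leNgt.
  rewrite (bigD1 i) //= (bigD1 j) /=; last by rewrite !inE eq_sym ij.
  by rewrite e eqxx -addrA lerDl addr_ge0 ?sumr_ge0.
rewrite avg_sum expr2 -mulrA mulr_natl -sumr_const; apply: ler_sum => i iQ.
rewrite avg_sum mulr_natl.
rewrite (eq_bigr (fun=> L^-1)) => [|j]; last first.
  by rewrite !inE eq_sym => /andP[ij _]; apply: avg_collision.
by rewrite sumr_const ler_wpMn2l ?invr_ge0 ?ler0n // subset_leq_card // subD1set.
Qed.

(** After expanding the squares, the diagonal contributes at most [beta] times the total weight, and
    every other pair collides with probability 1 / L. *)
Lemma avg_collision_weight (w : 'I_n -> R) (beta : R) :
  (forall i, 0 <= w i <= beta) ->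
  avg (fun phi : partition => \sum_a (\sum_(i | phi i == a) w i) ^+ 2) <=
  (\sum_i w i) ^+ 2 / L + beta * \sum_i w i.
Proof.
move=> hw; have w0 i : 0 <= w i by case/andP: (hw i).
rewrite (@eq_avg _ _ _ (fun phi : partition =>
    \sum_i \sum_j w i * w j * (phi i == phi j)%:R)); last first.
  move=> phi.
  transitivity (\sum_a \sum_i \sum_j (w i * (phi i == a)%:R) * (w j * (phi j == a)%:R)).
    apply: eq_bigr => a _.
    rewrite big_mkcond expr2 mulr_suml; apply: eq_bigr => i _; rewrite mulr_sumr.
    by apply: eq_bigr => j _; do 2!case: (_ == a); rewrite ?(mulr1, mulr0, mul0r).
  rewrite exchange_big; apply: eq_bigr => i _; rewrite exchange_big /=.
  apply: eq_bigr => j _; rewrite (bigD1 (phi i)) //= big1 ?addr0 => [|a].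
    by rewrite eqxx mulr1 mulrA eq_sym.
  by rewrite eq_sym => /negbTE ->; rewrite mulr0 mul0r.
rewrite avg_sum expr2 -mulrA mulr_suml mulr_sumr -big_split /=.
apply: ler_sum => i _; rewrite avg_sum.
rewrite mulr_suml mulr_sumr (bigD1 i) //= [X in _ <= X + _](bigD1 i) //=.
rewrite (eq_avg (G := fun=> w i * w i)) => [|phi]; last by rewrite eqxx mulr1.
rewrite (avg_cst part0).
have -> : \sum_(j | j != i) avg (fun phi : partition => w i * w j * (phi i == phi j)%:R) =
          \sum_(j | j != i) w i * (w j / L).
  by apply: eq_bigr => j ji; rewrite avgZ avg_collision 1?eq_sym // mulrA.
have : w i * w i <= beta * w i by rewrite ler_wpM2r //; case/andP: (hw i).
have : 0 <= w i * (w i / L) by rewrite !mulr_ge0 ?invr_ge0 ?ler0n.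
move=> p1 p2; rewrite addrAC; apply: lerD; last exact: lexx.
by apply: le_trans p2 _; rewrite lerDr.
Qed.

(** The set [Q] of [core_or_spread] is small enough for [phi] to be injective on it with probability
    at least 5/6, and then deleting m parts deletes at most m of its elements. In the spread case, a
    second moment bound makes a part with a large share of the weight unlikely. *)
Lemma random_partition (f : boolfun n) (m : nat) (eps beta : R) :
  (0 < m)%N -> 0 < eps -> 0 < beta ->
  (forall T : {set 'I_n}, (#|T| <= m)%N -> eps <= influence R f (~: T)) ->
  6 * (m.+1%:R / beta) ^+ 2 <= L -> 192 * m%:R ^+ 2 <= L ->
  576 * m%:R ^+ 2 * beta <= eps ->
  avg (fun phi : partition =>
    (~~ [forall S : {set 'I_l.+1}, (#|~: S| <= m)%N ==>
           (eps / 4 <= influence R f (phi @^-1: S))])%:R : R) <= 1 / 6.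
Proof.
move=> m0 eps0 beta0 hf hq hL hbeta.
have L0 : 0 < L by rewrite ltr0n.
have m0R : (0 : R) < m%:R by rewrite ltr0n.
have [c c0 hE] := influence_coverage R f.
have h1 : coverage c id setT <= 1 by rewrite -hE influence_le1.
(* The level eps / 3 exceeds eps / 4 and also equals eps - 2 * (eps / 3), the bound left by
   subadditivity in the second case. *)
have [Q [cQ hQ]] := core_or_spread c0 beta0 (eps / 3) m.+1 h1.
have small : #|Q|%:R ^+ 2 / L <= 1 / 6.
  rewrite ler_pdivrMr //.
  have : #|Q|%:R ^+ 2 <= (m.+1%:R / beta) ^+ 2
    by rewrite ler_sqr ?nnegrE ?ler0n // divr_ge0 ?ler0n ?(ltW beta0).
  lra.
have cV (phi : partition) (S : {set 'I_l.+1}) : {in Q &, injective phi} ->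
    (#|~: S| <= m)%N -> (#|Q :&: phi @^-1: (~: S)| <= m)%N.
  move=> inj; apply: leq_trans.
  rewrite -(@card_in_imset _ _ phi); last first.
    by move=> i j; rewrite !inE => /andP[iQ _] /andP[jQ _]; apply: inj.
  apply: subset_leq_card; apply/subsetP => a /imsetP[i].
  by rewrite !inE => /andP[_ iS] ->.
case: hQ => [hQ|hQ|[w [wb Wge wS]]].
- apply: le_trans (avg_not_injective _) small => phi inj; rewrite negbK.
  apply/forallP => S; apply/implyP => cS.
  apply: (le_trans (y := eps / 3)); first lra.
  apply: le_trans (hQ _ (cV _ _ inj cS)) _; rewrite hE; apply: coverageS => //.
  apply/subsetP => i; rewrite !inE => /andP[+ iQ].
  by rewrite iQ negbK.
- apply: le_trans (avg_not_injective _) small => phi inj; rewrite negbK.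
  apply/forallP => S; apply/implyP => cS.
  have := hf _ (cV _ _ inj cS).
  have : influence R f (~: (Q :&: phi @^-1: (~: S))) <=
         influence R f (~: Q) + influence R f (phi @^-1: S).
    apply: le_trans (influenceU _ _ _ _); apply: influenceS.
    by rewrite setCI; apply: setUS; apply/subsetP => i; rewrite !inE negbK.
  have : influence R f (~: Q) <= 2 * (eps / 3) by rewrite hE.
  lra.
set W := \sum_i w i in Wge.
have w0 i : 0 <= w i by case/andP: (wb i).
have W0 : 0 < W by lra.
set p := avg _.
(* Markov's inequality: a bad partition has a part heavier than W / (4 * m), so the sum of the
   squared part weights is at least the square of this. *)
suff le1 : p * (W / (4 * m%:R)) ^+ 2 <= W ^+ 2 / L + beta * W.
  have -> : p = p * (W / (4 * m%:R)) ^+ 2 * (16 * m%:R ^+ 2 / W ^+ 2).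
    by field; rewrite !gt_eqF.
  apply: (le_trans (y := (W ^+ 2 / L + beta * W) * (16 * m%:R ^+ 2 / W ^+ 2))).
    apply: ler_wpM2r le1; apply: divr_ge0; last exact: sqr_ge0.
    by apply: mulr_ge0; [exact: ler0n|exact: sqr_ge0].
  have -> : (W ^+ 2 / L + beta * W) * (16 * m%:R ^+ 2 / W ^+ 2) =
            16 * m%:R ^+ 2 / L + 16 * (m%:R ^+ 2 * beta) / W.
    by move: L^-1 => Li; field; rewrite !gt_eqF.
  have : 16 * m%:R ^+ 2 / L <= 1 / 12 by rewrite ler_pdivrMr //; lra.
  have : 16 * (m%:R ^+ 2 * beta) / W <= 1 / 12 by rewrite ler_pdivrMr //; lra.
  move=> q1 q2; apply: le_trans (lerD q2 q1) _; lra.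
apply: le_trans (avg_collision_weight wb); rewrite mulrC -avgZ; apply: ler_avg => phi.
case: (boolP [forall S, _]) => [_|].
  by rewrite mulr0; apply: sumr_ge0 => a _; apply: sqr_ge0.
rewrite negb_forall => /existsP[S]; rewrite negb_imply -ltNge mulr1 => /andP[cS hS].
(* If each of the at most m parts outside [S] weighed at most W / (4 * m), the parts in [S] would
   keep 3 * W / 4 >= eps / 4. *)
have [a aS Xa] : exists2 a, a \in ~: S & W / (4 * m%:R) < \sum_(i | phi i == a) w i.
  apply/exists_inP; apply: contraLR hS; rewrite negb_exists_in => /forall_inP hX.
  rewrite -leNgt.
  apply: (le_trans (y := W - \sum_(a in ~: S) \sum_(i | phi i == a) w i)).
    have : \sum_(a in ~: S) \sum_(i | phi i == a) w i <= \sum_(a in ~: S) W / (4 * m%:R).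
      by apply: ler_sum => a /hX; rewrite -leNgt.
    have : \sum_(a in ~: S) W / (4 * m%:R) <= W / 4.
      rewrite sumr_const -[_ *+ _]mulr_natr.
      have -> : W / 4 = W / (4 * m%:R) * m%:R by field; rewrite gt_eqF.
      by rewrite ler_wpM2l ?ler_nat // divr_ge0 ?mulr_ge0 ?ltW.
    lra.
  have -> : \sum_(a in ~: S) \sum_(i | phi i == a) w i = \sum_(i in ~: (phi @^-1: S)) w i.
    rewrite (exchange_big_dep (fun i => i \in ~: (phi @^-1: S))) /=; last first.
      by move=> a i aS /eqP e; rewrite !inE e -in_setC.
    apply: eq_bigr => i; rewrite !inE => iS.
    rewrite (big_pred1 (phi i)) // => a; rewrite !inE [phi i == a]eq_sym.
    by case: (eqVneq a (phi i)) => [->|]; rewrite ?andbT ?andbF ?iS.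
  rewrite lerBlDr hE; apply: le_trans (lerD (wS _) (lexx _)).
  rewrite /W (bigID (mem (phi @^-1: S))) /=.
  by under [X in _ + X <= _]eq_bigl do rewrite -in_setC.
rewrite (bigD1 a) //=; apply: ler_wpDr; first by apply: sumr_ge0 => b _; apply: sqr_ge0.
rewrite ler_sqr ?nnegrE; [exact: ltW| |exact: sumr_ge0].
by rewrite ltW // divr_gt0 // mulr_gt0.
Qed.

End Partition.

(** * Subgradient descent *)

Section Descent.
Variables (R : realType) (n l : nat) (phi : {ffun 'I_n -> 'I_l.+1}).
Variables lam eta theta : R.
Notation point := {ffun 'I_l.+1 -> R}.
Notation L := (l.+1%:R : R).
Implicit Types (z g : point) (f : boolfun n).

Definition clip (a : R) : R := Num.min 1 (Num.max 0 a).

Lemma clip_itv a : 0 <= clip a <= 1.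
Proof. by rewrite le_min ler01 le_max lexx /= ge_min lexx. Qed.

Lemma clip_contract a u : 0 <= u <= 1 -> (clip a - u) ^+ 2 <= (a - u) ^+ 2.
Proof.
case/andP=> u0 u1; rewrite /clip /Num.min /Num.max.
by case: (ltrP 0 a) => a0; case: ltrP => a1; nra.
Qed.

(** Position in the order of decreasing [z]; sorting breaks ties, which keeps [rank z] injective. *)
Definition rank z (i : 'I_l.+1) : nat :=
  index i (sort (fun i j => z j <= z i) (enum 'I_l.+1)).

Lemma rank_inj z : injective (rank z).
Proof.
by move=> i j; apply: (index_inj i); rewrite mem_sort mem_enum.
Qed.

Lemma rank_le z i j : (rank z i <= rank z j)%N -> z j <= z i.
Proof.
apply: (@sorted_leq_index _ (fun i j => z j <= z i)); rewrite ?mem_sort ?mem_enum //.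
- by move=> a b c ba ac; apply: le_trans ac ba.
- by apply: sort_sorted => a b; apply: le_total.
Qed.

Definition cut z (xy : cube n * cube n) (S : {set 'I_l.+1}) : cube n :=
  hybrid (phi @^-1: S) xy.1 xy.2.

Definition queries z xy : seq (cube n) :=
  xy.1 :: [seq cut z xy (upto (rank z) i) | i <- enum 'I_l.+1] ++
          [seq cut z xy (before (rank z) i) | i <- enum 'I_l.+1].

Lemma size_queries z xy : size (queries z xy) = (l.+1 + l.+1).+1.
Proof. by rewrite /= size_cat 2!size_map size_enum_ord. Qed.

Arguments queries : simpl never.

(** Recovers the gradient from the answers alone, by the layout of [queries]: index 0 is the base
    point, then come [l.+1] answers for [upto] and [l.+1] for [before]. *)
Definition decode (bs : seq bool) : point :=
  [ffun i : 'I_l.+1 => (nth false bs 0 != nth false bs i.+1)%:R -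
     (nth false bs 0 != nth false bs (l.+1 + i).+1)%:R - lam].

(* An unbiased estimate of a subgradient, at z, of the Lovász extension of
   S |-> influence f (phi @^-1: S) - lam * #|S|. *)
Definition gradient f z xy : point :=
  [ffun i => (f xy.1 != f (cut z xy (upto (rank z) i)))%:R -
     (f xy.1 != f (cut z xy (before (rank z) i)))%:R - lam].

Lemma decode_queries f z xy : decode (map f (queries z xy)) = gradient f z xy.
Proof.
have nthE (q : 'I_l.+1 -> cube n) (i : 'I_l.+1) :
    nth false (map f (map q (enum 'I_l.+1))) i = f (q i).
  rewrite (nth_map (cube0 n)); last by rewrite size_map size_enum_ord.
  by rewrite (nth_map ord0) ?size_enum_ord // nth_ord_enum.
apply/ffunP => i; rewrite !ffunE /queries /= map_cat !nth_cat 2!size_map size_enum_ord.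
by rewrite ltn_ord ltnNge leq_addr /= addKn !nthE.
Qed.

Definition descend z g : point := [ffun i => clip (z i - eta * g i)].

(** The shift [lam * L] turns the term [- lam * #|S|] of the extension into the penalty
    [lam * #|~: S|], to be compared with [theta]. *)
Definition score z g (s : R) : R := s + \sum_i g i * z i + lam * L - theta.

Fixpoint rounds (t : nat) z (s : R) : algorithm n :=
  if t is t'.+1 then
    sample (cube0 n, cube0 n) (fun xy => ask (queries z xy) (fun bs =>
      rounds t' (descend z (decode bs)) (score z (decode bs) s)))
  else Output n (s <= 0).

Lemma output_prob_rounds f b t z s : output_prob R f b (rounds t.+1 z s) =
  avg (fun xy => output_prob R f b
    (rounds t (descend z (gradient f z xy)) (score z (gradient f z xy) s))).
Proof.
rewrite [rounds _ _ _]/= output_prob_sample; apply: eq_avg => xy.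
by rewrite /= output_prob_ask decode_queries.
Qed.

Lemma query_count_rounds f t z s :
  (query_count f (rounds t z s) <= t * (l.+1 + l.+1).+1)%N.
Proof.
elim: t z s => // t IH z s; rewrite [rounds _ _ _]/=.
apply: query_count_sample => xy.
apply: (leq_trans (eq_leq (query_count_ask f (queries z xy)
  (fun bs => rounds t (descend z (decode bs)) (score z (decode bs) s))))).
by rewrite mulSn size_queries leq_add2l.
Qed.

Variable f : boolfun n.
Let h (S : {set 'I_l.+1}) := influence R f (phi @^-1: S).

(** A set meets the preimage of [S] exactly when its image under [phi] meets [S], so merging
    coordinates preserves coverage functions. *)
Lemma part_coverage : exists2 c : {set 'I_n} -> R,
  forall A, 0 <= c A & forall S, h S = coverage c (fun A => phi @: A) S.
Proof.
have [c c0 hE] := influence_coverage R f; exists c => // S.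
rewrite /h hE; apply: eq_bigr => A _; congr (_ * (nat_of_bool _)%:R).
apply/hitsP/hitsP => [[i iA]|[a /imsetP[i iA ->] iS]].
  by rewrite inE => iS; exists (phi i) => //; apply: imset_f.
by exists i; rewrite // inE.
Qed.

Lemma gradient_itv z xy i : 0 <= lam <= 1 -> -2 <= gradient f z xy i <= 1.
Proof.
case/andP=> lam0 lam1.
by rewrite ffunE; do 2!case: (_ != _) => /=; apply/andP; split; lra.
Qed.

Lemma sum_ord_const (a : R) : \sum_(i < l.+1) a = a * L.
Proof. by rewrite sumr_const card_ord mulr_natr. Qed.

Lemma sum_gradient_itv z xy (x : 'I_l.+1 -> R) :
  0 <= lam <= 1 -> (forall i, 0 <= x i <= 1) ->
  - (2 * L) <= \sum_i gradient f z xy i * x i <= L.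
Proof.
move=> lam01 hx.
have -> : - (2 * L) = \sum_(i < l.+1) -2 by rewrite sum_ord_const mulNr.
have -> : L = \sum_(i < l.+1) 1 by rewrite sum_ord_const mul1r.
by apply/andP; split; apply: ler_sum => i _;
  have /andP[? ?] := hx i; have /andP[? ?] := gradient_itv z xy i lam01; nra.
Qed.

Lemma avg_gradient z c (x : 'I_l.+1 -> R) :
  (forall S, h S = coverage c (fun A : {set 'I_n} => phi @: A) S) ->
  avg (fun xy => \sum_i gradient f z xy i * x i) =
  \sum_i marginal c (fun A : {set 'I_n} => phi @: A) (rank z) i * x i - lam * \sum_i x i.
Proof.
move=> hE; rewrite avg_sum mulr_sumr -sumrB; apply: eq_bigr => i _.
under eq_avg do rewrite mulrC.
rewrite avgZ mulrC -mulrBl; congr (_ * _); rewrite /marginal -!hE /h /influence.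
rewrite -[in RHS](avg_cst (cube0 n, cube0 n) lam) -!avgN -!avgD.
by apply: eq_avg => xy; rewrite ffunE.
Qed.

(** Regret against the indicator of [S0]: the score plus the squared distance to this indicator over
    [2 * eta] falls by at least [gamma] per round, up to a fluctuation of nonpositive mean and size
    at most 4 * L. *)
Lemma reject_rounds (S0 : {set 'I_l.+1}) (gamma D : R) t :
  0 <= lam <= 1 -> 0 < eta -> theta <= 1 -> 0 < D -> 0 <= gamma ->
  h S0 + lam * #|~: S0|%:R + 2 * eta * L + gamma <= theta ->
  output_prob R f false (rounds t [ffun=> 0] 0) * D ^+ 2 <=
  Num.max 0 (L / (2 * eta) - t%:R * gamma + D) ^+ 2 + t%:R * (16 * L ^+ 2).
Proof.
move=> lam01 eta0 theta1 D0 gamma0 hS0; have /andP[lam0 lam1] := lam01.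
have L1 : 1 <= L by rewrite -[1]/(1%:R) ler_nat.
pose u i : R := (i \in S0)%:R.
have u01 i : 0 <= u i <= 1 by rewrite /u; case: (_ \in _); rewrite /= ?lexx ler01.
pose W (st : point * R) := st.2 + (\sum_i (st.1 i - u i) ^+ 2) / (2 * eta).
pose next (st : point * R) xy :=
  (descend st.1 (gradient f st.1 xy), score st.1 (gradient f st.1 xy) st.2).
pose P t (st : point * R) := output_prob R f false (rounds t st.1 st.2).
pose inv (st : point * R) := forall i, 0 <= st.1 i <= 1.
have eta2 : 0 < 2 * eta by lra.
have W0 : W ([ffun=> 0], 0) <= L / (2 * eta).
  rewrite /W add0r ler_wpM2r ?invr_ge0 ?(ltW eta2) //=.
  rewrite -[leRHS]mul1r -sum_ord_const; apply: ler_sum => i _.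
  by rewrite ffunE sub0r sqrrN /u; case: (_ \in _); rewrite ?expr1n ?expr0n.
have hW (z : point) s : inv (z, s) -> exists xi : cube n * cube n -> R,
    [/\ forall xy, W (next (z, s) xy) <= W (z, s) + xi xy - gamma, avg xi <= 0
      & forall xy, xi xy ^+ 2 <= 16 * L ^+ 2].
  move=> zI.
  exists (fun xy => \sum_i gradient f z xy i * u i + (lam * L - theta + 2 * eta * L + gamma)).
  split=> [xy||xy].
  - rewrite /W /next /score /=.
    set g := gradient f z xy.
    (* Expanding the square leaves an error [eta * g i ^+ 2 / 2], at most [2 * eta] per coordinate
       because |g i| <= 2. *)
    have : (\sum_i (descend z g i - u i) ^+ 2) / (2 * eta) <=
        (\sum_i (z i - u i) ^+ 2) / (2 * eta)
        - \sum_i g i * z i + \sum_i g i * u i + 2 * eta * L.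
      rewrite -sum_ord_const; set e2 := 2 * eta in eta2 *.
      rewrite ler_pdivrMr // !mulrDl divfK ?gt_eqF // mulNr !mulr_suml.
      rewrite -sumrB -!big_split /=; apply: ler_sum => i _.
      have /andP[g1 g2] := gradient_itv z xy i lam01.
      rewrite -/g in g1 g2.
      rewrite [descend _ _ _]ffunE; apply: le_trans (clip_contract _ (u01 i)) _.
      have : g i ^+ 2 <= 4 by nra.
      have := mulr_gt0 eta0 eta0; rewrite /e2.
      nra.
    lra.
  - have [c c0 hE] := part_coverage.
    rewrite avgD (avg_cst (cube0 n, cube0 n)) (avg_gradient _ _ hE).
    have : \sum_i marginal c (fun A : {set 'I_n} => phi @: A) (rank z) i * u i <= h S0.
      rewrite hE; apply: le_trans (sum_marginal_le _ c0 (@rank_inj z) S0).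
      rewrite [leRHS]big_mkcond; apply: ler_sum => i _.
      by rewrite /u; case: (i \in S0); rewrite ?mulr1 ?mulr0.
    have -> : \sum_i u i = #|S0|%:R.
      rewrite -sum1_card natr_sum [RHS]big_mkcond /=; apply: eq_bigr => i _.
      by rewrite /u; case: (i \in S0).
    have : lam * L = lam * #|S0|%:R + lam * #|~: S0|%:R.
      by rewrite -mulrDr -natrD cardsC card_ord.
    lra.
  - have /andP[g1 g2] := sum_gradient_itv z xy lam01 u01.
    have lamL : 0 <= lam * L <= L by rewrite mulr_ge0 //= ler_piMl.
    have h0 : 0 <= h S0 + lam * #|~: S0|%:R.
      have [c c0 hE] := part_coverage; apply: addr_ge0; last exact: mulr_ge0.
      by rewrite hE; apply: coverage_ge0.
    have etaL : 0 <= 2 * eta * L by rewrite mulr_ge0 // ltW.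
    have -> : 16 * L ^+ 2 = (4 * L) ^+ 2 by ring.
    rewrite -ler_sqrt ?sqr_ge0 // !sqrtr_sqr [leRHS]ger0_norm; last by rewrite mulr_ge0.
    by case/andP: lamL => lL1 lL2; rewrite ler_norml; apply/andP; split; lra.
have inv0 : inv ([ffun=> 0], 0) by move=> i; rewrite ffunE lexx ler01.
have := @drift_bound _ _ _ (cube0 n, cube0 n) P next inv W gamma (16 * L ^+ 2) D D0.
move=> /(_ _ _ _ _ _ t _ inv0) /=.
rewrite /P /= => db; apply: le_trans (db _ _ _ _ _) _ => {db}.
- by move=> st; case: (_ == _).
- move=> [z s] zI /=; case: (lerP s 0) => s0 /=; rewrite ?ltxx // => _.
  apply: addr_ge0; first exact: ltW.
  by apply: divr_ge0 (ltW eta2); apply: sumr_ge0 => i _; apply: sqr_ge0.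
- by move=> t' [z s]; apply: output_prob_rounds.
- by move=> [z s] xy _ i; rewrite ffunE clip_itv.
- by move=> [z s] /hW.
rewrite lerD2r ler_sqr ?nnegrE; [|by rewrite le_max lexx..].
by rewrite ge_max !le_max lexx /= !lerD2r W0 orbT.
Qed.

(** By [lovasz_ge] the penalized extension is at least [theta + gamma] at every point visited, so
    the score alone drifts upwards, wherever the descent goes. *)
Lemma accept_rounds (gamma D : R) t :
  0 <= lam <= 1 -> 0 <= theta -> 0 < D -> 0 <= gamma ->
  (forall S, theta + gamma <= h S + lam * #|~: S|%:R) ->
  output_prob R f true (rounds t [ffun=> 0] 0) * D ^+ 2 <=
  Num.max 0 (- (t%:R * gamma) + D) ^+ 2 + t%:R * (16 * L ^+ 2).
Proof.
move=> lam01 theta0 D0 gamma0 hS; have /andP[lam0 lam1] := lam01.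
have L1 : 1 <= L by rewrite -[1]/(1%:R) ler_nat.
pose W (st : point * R) := - st.2.
pose next (st : point * R) xy :=
  (descend st.1 (gradient f st.1 xy), score st.1 (gradient f st.1 xy) st.2).
pose P t (st : point * R) := output_prob R f true (rounds t st.1 st.2).
pose inv (st : point * R) := forall i, 0 <= st.1 i <= 1.
have [c c0 hE] := part_coverage.
have lamL : 0 <= lam * L <= L by rewrite mulr_ge0 //= ler_piMl.
have hW (z : point) s : inv (z, s) -> exists xi : cube n * cube n -> R,
    [/\ forall xy, W (next (z, s) xy) <= W (z, s) + xi xy - gamma, avg xi <= 0
      & forall xy, xi xy ^+ 2 <= 16 * L ^+ 2].
  move=> zI.
  exists (fun xy => - (\sum_i gradient f z xy i * z i) + (- (lam * L) + theta + gamma)).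
  split=> [xy||xy].
  - by rewrite /W /next /score /=; lra.
  - rewrite avgD (avg_cst (cube0 n, cube0 n)) avgN (avg_gradient _ _ hE).
    rewrite sum_marginal_max; [|exact: rank_inj|by move=> i; case/andP: (zI i)|exact: rank_le].
    have nuS S : theta + gamma - lam * L <=
        coverage c (fun A : {set 'I_n} => phi @: A) S - lam * #|S|%:R.
      have := hS S; rewrite hE.
      have -> : L = #|S|%:R + #|~: S|%:R by rewrite -natrD cardsC card_ord.
      lra.
    have := lovasz_ge c0 nuS zI ler01.
    lra.
  - have /andP[g1 g2] := sum_gradient_itv z xy lam01 zI.
    have thL : theta + gamma <= lam * L.
      have := hS set0; rewrite hE coverage0 add0r setC0 cardsT card_ord; exact.
    have -> : 16 * L ^+ 2 = (4 * L) ^+ 2 by ring.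
    rewrite -ler_sqrt ?sqr_ge0 // !sqrtr_sqr [leRHS]ger0_norm; last by rewrite mulr_ge0.
    by case/andP: lamL => lL1 lL2; rewrite ler_norml; apply/andP; split; lra.
have inv0 : inv ([ffun=> 0], 0) by move=> i; rewrite ffunE lexx ler01.
have := @drift_bound _ _ _ (cube0 n, cube0 n) P next inv W gamma (16 * L ^+ 2) D D0.
move=> /(_ _ _ _ _ _ t _ inv0) /=.
rewrite /P /= => db; apply: le_trans (db _ _ _ _ _) _ => {db}.
- by move=> st; case: (_ == _).
- by move=> [z s] zI /=; rewrite /W oppr_ge0 /=; case: (lerP s 0); rewrite ?ltxx.
- by move=> t' [z s]; apply: output_prob_rounds.
- by move=> [z s] xy _ i; rewrite ffunE clip_itv.
- by move=> [z s] /hW.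
by rewrite /W /= oppr0 add0r.
Qed.

End Descent.

(** * The tester *)

Section Tester.
Variable R : realType.

(** With [beta = eps / (100 ^+ 2 * k ^+ 2)] and [m = 4 * k], [random_partition] needs 6 * (m.+1 /
    beta) ^+ 2 parts, where m.+1 <= 5 * k; and 16 ^+ 2 exceeds 6 * 5 ^+ 2. *)
Definition part_count (k : nat) (eps : R) : nat :=
  Num.truncn ((16 * 100 ^+ 2 * (k%:R ^+ 3 / eps)) ^+ 2).

Definition round_count (k : nat) (eps : R) : nat :=
  (Num.truncn (128 ^+ 3 * ((part_count k eps).+1%:R / eps) ^+ 2)).+1.

(** The threshold is the midpoint of 3 * eps / 16 and eps / 4. The step size makes the regret term
    [2 * eta * L] equal to eps / 64, half of the margin eps / 32; the other half is the drift per
    round. *)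
Definition tester (n k : nat) (eps : R) : algorithm n :=
  sample (part0 n (part_count k eps)) (fun phi =>
    rounds phi (eps / (16 * k%:R)) (eps / (128 * (part_count k eps).+1%:R))
      (7 * eps / 32) (round_count k eps) [ffun=> 0] 0).

Lemma truncnS_itv (x : R) : 1 <= x -> x <= (Num.truncn x).+1%:R <= 2 * x.
Proof.
move=> x1; rewrite ltW ?truncnS_gt //=.
have : (Num.truncn x)%:R <= x by rewrite truncn_le; lra.
by rewrite -natr1; lra.
Qed.

Lemma parts_itv k (eps : R) : (1 <= k)%N -> 0 < eps -> eps < 1 ->
  (16 * 100 ^+ 2 * (k%:R ^+ 3 / eps)) ^+ 2 <= (part_count k eps).+1%:R
    <= 2 * (16 * 100 ^+ 2 * (k%:R ^+ 3 / eps)) ^+ 2.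
Proof.
move=> k1 e0 e1; apply: truncnS_itv; rewrite exprn_ege1 //.
rewrite mulr_ege1 //; first lra.
by rewrite ler_pdivlMr // mul1r (le_trans (ltW e1)) // exprn_ege1 // ler1n.
Qed.

Lemma rounds_itv k (eps : R) : 0 < eps -> eps < 1 ->
  128 ^+ 3 * ((part_count k eps).+1%:R / eps) ^+ 2 <= (round_count k eps)%:R
    <= 2 * (128 ^+ 3 * ((part_count k eps).+1%:R / eps) ^+ 2).
Proof.
move=> e0 e1; apply: truncnS_itv; rewrite mulr_ege1 //; first lra.
rewrite exprn_ege1 // ler_pdivlMr // mul1r (le_trans (ltW e1)) // ler1n //.
Qed.

(** Once the squared positive part in the drift bound vanishes, the ratio 16 * T * L ^+ 2 / D ^+ 2
    remains, and it is at most 16 / 128. *)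
Lemma failure_bound (p L T eps D : R) : 0 < eps -> 0 < L -> 0 <= p ->
  128 ^+ 3 * (L / eps) ^+ 2 <= T -> T * (eps / 64) / 2 <= D ->
  p * D ^+ 2 <= T * (16 * L ^+ 2) -> p <= 1 / 6.
Proof.
move=> e0 L0 p0 hT hD hp.
have T0 : 0 < T by apply: lt_le_trans hT; rewrite mulr_gt0 // exprn_gt0 // divr_gt0.
have L2 : 0 < L ^+ 2 by rewrite exprn_gt0.
have hT2 : 128 ^+ 3 * L ^+ 2 <= T * eps ^+ 2.
  have -> : 128 ^+ 3 * L ^+ 2 = 128 ^+ 3 * (L / eps) ^+ 2 * eps ^+ 2.
    by field; rewrite gt_eqF.
  by rewrite ler_wpM2r ?sqr_ge0.
have D2 : (T * (eps / 64) / 2) ^+ 2 <= D ^+ 2.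
  have t0 : 0 <= T * (eps / 64) / 2 by rewrite !mulr_ge0 ?invr_ge0 ?(ltW T0) ?(ltW e0) ?ler0n.
  by rewrite ler_sqr ?nnegrE // (le_trans t0).
have T128 : 128 * (T * L ^+ 2) <= (T * (eps / 64) / 2) ^+ 2.
  have -> : (T * (eps / 64) / 2) ^+ 2 = T / (128 ^+ 2) * (T * eps ^+ 2) by field.
  have -> : 128 * (T * L ^+ 2) = T / (128 ^+ 2) * (128 ^+ 3 * L ^+ 2) by field.
  by rewrite ler_wpM2l // divr_ge0 ?(ltW T0) // exprn_ge0.
have TL : 0 < T * L ^+ 2 by rewrite mulr_gt0.
have : p * (128 * (T * L ^+ 2)) <= 16 * (T * L ^+ 2).
  apply: (le_trans (y := p * D ^+ 2)); first by rewrite ler_wpM2l // (le_trans T128).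
  by apply: le_trans hp _; rewrite mulrCA.
rewrite mulrA ler_pM2r //; lra.
Qed.

Lemma tester_accepts n k (eps : R) (f : boolfun n) :
  (1 <= k)%N -> 0 < eps -> eps < 1 ->
  (exists g : boolfun n, junta k g /\ close (eps / 16%:R) f g) ->
  output_prob R f false (tester n k eps) <= 1 / 6.
Proof.
move=> k1 e0 e1 [g [[S [cS gS]] fg]]; rewrite /close in fg.
have hS := close_influence R f gS.
have kR : (1 : R) <= k%:R by rewrite ler1n.
rewrite /tester output_prob_sample -[leRHS](avg_cst (part0 n (part_count k eps))).
apply: ler_avg => phi.
have := rounds_itv k e0 e1; move: (round_count k eps) => t.
move: (part_count k eps) phi => l phi; set L : R := l.+1%:R => /andP[ht _].
have L0 : 0 < L by rewrite ltr0n.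
(* Chosen to cancel the initial potential [L / (2 * eta)], which is 64 * L ^+ 2 / eps, against the
   total drift; by [tD] at least half of the drift is left. *)
pose D : R := t%:R * (eps / 64) - 64 * L ^+ 2 / eps.
have tD : 2 * (64 * L ^+ 2 / eps) <= t%:R * (eps / 64).
  have -> : 2 * (64 * L ^+ 2 / eps) = (64 * 128 * (L / eps) ^+ 2) * (eps / 64).
    by field; rewrite gt_eqF.
  rewrite ler_pM2r ?divr_gt0 //; apply: le_trans ht.
  by rewrite ler_wpM2r ?sqr_ge0 //; lra.
have x0 : 0 < 64 * L ^+ 2 / eps by rewrite divr_gt0 // mulr_gt0 // exprn_gt0.
have lamk : eps / (16 * k%:R) * k%:R = eps / 16 by field; lra.
have lam0 : 0 < eps / (16 * k%:R) by rewrite divr_gt0 // mulr_gt0 //; lra.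
apply: (failure_bound e0 L0 (output_prob_ge0 _ _ _ _) ht (D := D)).
  by rewrite /D; lra.
(* The comparison set omits the at most k parts that contain junta coordinates: influence at most
   eps / 8, penalty at most eps / 16. *)
have db := @reject_rounds R n l phi (eps / (16 * k%:R)) (eps / (128 * L))
  (7 * eps / 32) f (~: (phi @: S)) (eps / 64) D t.
apply: le_trans (db _ _ _ _ _ _) _ => {db}.
- rewrite (ltW lam0) /=; nra.
- by rewrite divr_gt0 // mulr_gt0.
- lra.
- by rewrite /D; lra.
- lra.
- have -> : 2 * (eps / (128 * L)) * L = eps / 64.
    by move: (L) L0 => M M0; field; rewrite gt_eqF.
  have : influence R f (phi @^-1: (~: (phi @: S))) <= eps / 8.
    apply: le_trans (_ : influence R f (~: S) <= _); last lra.
    by apply: influenceS; apply/subsetP => i; rewrite !inE; apply: contra; apply: imset_f.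
  have : eps / (16 * k%:R) * #|~: ~: (phi @: S)|%:R <= eps / 16.
    rewrite -lamk ler_pM2l // ler_nat setCK.
    exact: leq_trans (leq_imset_card _ _) cS.
  lra.
have -> : L / (2 * (eps / (128 * L))) - t%:R * (eps / 64) + D = 0.
  by rewrite /D; move: (L) L0 => M M0; field; rewrite !gt_eqF.
by rewrite maxxx expr0n add0r.
Qed.

Lemma tester_rejects n k (eps : R) (f : boolfun n) :
  (1 <= k)%N -> 0 < eps -> eps < 1 ->
  (forall g : boolfun n, junta (4 * k) g -> far eps f g) ->
  output_prob R f true (tester n k eps) <= 1 / 3.
Proof.
move=> k1 e0 e1 hfar.
have kR : (1 : R) <= k%:R by rewrite ler1n.
pose bad (phi : {ffun 'I_n -> 'I_(part_count k eps).+1}) : R :=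
  (~~ [forall S : {set 'I_(part_count k eps).+1}, (#|~: S| <= 4 * k)%N ==>
           (eps / 4 <= influence R f (phi @^-1: S))])%:R.
have hbad : avg bad <= 1 / 6.
  (* The factor 100 ^+ 2 is there because 576 * 4 ^+ 2 <= 100 ^+ 2. *)
  pose beta := eps / (100 ^+ 2 * k%:R ^+ 2).
  have k2 : 0 < k%:R ^+ 2 :> R by rewrite exprn_gt0 //; lra.
  have beta0 : 0 < beta by rewrite divr_gt0 // mulr_gt0 // exprn_gt0.
  have := parts_itv k1 e0 e1; set x := _ ^+ 3 / eps => /andP[hL _].
  have xk : k%:R ^+ 2 <= x.
    rewrite /x ler_pdivlMr //.
    have : k%:R ^+ 2 * eps <= k%:R ^+ 2 * k%:R by rewrite ler_pM2l //; lra.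
    by rewrite -exprSr.
  apply: (random_partition (m := 4 * k) (beta := beta)) => //.
  - by rewrite muln_gt0.
  - by move=> T cT; apply: far_influence cT.
  - apply: le_trans hL.
    have : (4 * k).+1%:R / beta <= 5 * 100 ^+ 2 * x.
      have -> : 5 * 100 ^+ 2 * x = 5 * k%:R / beta.
        by rewrite /x /beta; field; rewrite !gt_eqF //; lra.
      rewrite ler_pM2r ?invr_gt0 // -natr1 natrM; lra.
    rewrite -ler_sqr ?nnegrE; last 2 first.
    + by rewrite divr_ge0 // ltW.
    + by rewrite mulr_ge0 //; lra.
    have : 0 <= x ^+ 2 by rewrite sqr_ge0.
    rewrite !exprMn; lra.
  - apply: le_trans hL; rewrite natrM.
    have : k%:R ^+ 2 <= x ^+ 2.
      have : k%:R ^+ 2 * 1 <= k%:R ^+ 2 * k%:R ^+ 2 :> R.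
        by rewrite ler_pM2l // exprn_ege1.
      have : k%:R ^+ 2 * k%:R ^+ 2 <= x * x by apply: ler_pM; rewrite ?(ltW k2).
      by rewrite mulr1 -(expr2 x) => ? ?; lra.
    rewrite !exprMn; lra.
  - have -> : 576 * (4 * k)%:R ^+ 2 * beta = eps * (576 * 16 / 100 ^+ 2).
      by rewrite natrM /beta; field; rewrite gt_eqF //; lra.
    by rewrite ger_pMr //; lra.
rewrite /tester output_prob_sample.
(* A bad partition is counted as a failure; on a good one the descent fails with probability at most
   1 / 6. *)
apply: (le_trans (y := avg (fun phi => bad phi + 1 / 6))); last first.
  by rewrite avgD (avg_cst (part0 n (part_count k eps))); lra.
apply: ler_avg => phi; rewrite /bad.
case: (boolP [forall S, _]) => [/forallP good|_]; last first.
  by apply: le_trans (output_prob_le1 _ _ _ _) _; rewrite /=; lra.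
rewrite add0r {hbad bad}.
have := rounds_itv k e0 e1; move: (round_count k eps) => t.
move: (part_count k eps) phi good => l phi good; set L : R := l.+1%:R => /andP[ht _].
have L0 : 0 < L by rewrite ltr0n.
have t0 : 0 < t%:R :> R.
  by apply: lt_le_trans ht; rewrite mulr_gt0 // exprn_gt0 // divr_gt0.
have lamk : eps / (16 * k%:R) * (4 * k%:R) = eps / 4 by field; lra.
have lam0 : 0 < eps / (16 * k%:R) by rewrite divr_gt0 // mulr_gt0 //; lra.
have D0 : 0 < t%:R * (eps / 64) by rewrite mulr_gt0 // divr_gt0.
apply: (failure_bound e0 L0 (output_prob_ge0 _ _ _ _) ht (D := t%:R * (eps / 64))).
  lra.
have db := @accept_rounds R n l phi (eps / (16 * k%:R)) (eps / (128 * L))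
  (7 * eps / 32) f (eps / 64) (t%:R * (eps / 64)) t.
apply: le_trans (db _ _ _ _ _) _ => {db} //.
- rewrite (ltW lam0) /=; nra.
- lra.
- lra.
- move=> S.
  have lam_ge0 : 0 <= eps / (16 * k%:R) * #|~: S|%:R by rewrite mulr_ge0 // ltW.
  have inf_ge0 : 0 <= influence R f (phi @^-1: S).
    by have [c c0 ->] := influence_coverage R f; apply: coverage_ge0.
  have /implyP := good S; case: leqP => [_ /(_ isT)|cS _]; first lra.
  have : eps / 4 <= eps / (16 * k%:R) * #|~: S|%:R.
    by rewrite -lamk ler_pM2l // -natrM ler_nat ltnW.
  lra.
by rewrite addNr maxxx expr0n add0r.
Qed.

(** A round costs 2 * L + 1 <= 3 * L queries and there are order (L / eps) ^+ 2 rounds, with [L] of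
    order (k ^+ 3 / eps) ^+ 2. *)
Lemma tester_queries n k (eps : R) (f : boolfun n) :
  (1 <= k)%N -> 0 < eps -> eps < 1 ->
  (query_count f (tester n k eps))%:R <=
  48 * 128 ^+ 3 * (16 * 100 ^+ 2) ^+ 6 * k%:R ^+ 18 * eps^-1 ^+ 8.
Proof.
move=> k1 e0 e1.
have le : (query_count f (tester n k eps) <=
    round_count k eps * ((part_count k eps).+1 + (part_count k eps).+1).+1)%N.
  by apply: query_count_sample => phi; apply: query_count_rounds.
have /andP[_ ht] := rounds_itv k e0 e1.
have := parts_itv k1 e0 e1; set x := 16 * _ * (_ / _) => /andP[_ hL].
set L : R := (part_count k eps).+1%:R in ht hL *.
have L1 : 1 <= L by rewrite ler1n.
apply: (le_trans (y := (2 * (128 ^+ 3 * (L / eps) ^+ 2)) * (3 * L))).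
  rewrite -(ler_nat R) in le; apply: (le_trans le); rewrite natrM.
  apply: ler_pM => //; rewrite -natr1 natrD -/L; lra.
have -> : 2 * (128 ^+ 3 * (L / eps) ^+ 2) * (3 * L) =
          6 * 128 ^+ 3 * eps^-1 ^+ 2 * L ^+ 3 by field; rewrite gt_eqF.
have -> : 48 * 128 ^+ 3 * (16 * 100 ^+ 2) ^+ 6 * k%:R ^+ 18 * eps^-1 ^+ 8 =
          6 * 128 ^+ 3 * eps^-1 ^+ 2 * (2 * x ^+ 2) ^+ 3.
  by rewrite /x; field; rewrite gt_eqF.
rewrite ler_wpM2l //; last by rewrite lerXn2r ?nnegrE // (le_trans _ hL) //; lra.
by rewrite !mulr_ge0 // ?exprn_ge0 // invr_ge0 ltW.
Qed.

End Tester.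

(* p.[k%:R, eps^-1] is the value of the bivariate polynomial p at (k, 1/eps). *)
Theorem theorem1p1 (R : realType) :
  exists (A : forall n : nat, nat -> R -> algorithm n) (p : {poly {poly R}}),
  forall (n k : nat) (eps : R) (f : boolfun n),
    (1 <= k)%N -> 0 < eps -> eps < 1 ->
    [/\ (exists g : boolfun n, junta k g /\ close (eps / 16%:R) f g) ->
          2%:R / 3%:R <= accept_prob R f (A n k eps),
        (forall g : boolfun n, junta (4 * k) g -> far eps f g) ->
          2%:R / 3%:R <= reject_prob R f (A n k eps)
      & (query_count f (A n k eps))%:R <= p.[k%:R%:P].[eps^-1] ].
Proof.
exists (fun n => @tester R n).
exists (((48 * 128 ^+ 3 * (16 * 100 ^+ 2) ^+ 6) *: 'X^8)%:P * 'X^18).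
move=> n k eps f k1 e0 e1; rewrite /accept_prob /reject_prob.
have pC : output_prob R f true (tester n k eps) +
  output_prob R f false (tester n k eps) = 1 := output_probC R f true _.
split.
- by move=> hclose; have := tester_accepts k1 e0 e1 hclose; lra.
- by move=> hfar; have := tester_rejects k1 e0 e1 hfar; lra.
rewrite hornerM hornerXn hornerC -polyC_exp hornerM hornerC hornerZ hornerXn mulrAC.
exact: tester_queries.
Qed.
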